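(* Let $k$ be a field and let $(\Lambda,G,\eta)$ be an admissible set of data such that $L=\Lambda/G$ is totally ordered and identified, as an ordered set, with $\{0\}\cup\mathbb{N}$. Let $(l',c')$, $(l'',c'')$ be conjugacy classes of partial elements and $c$ a conjugacy class of $G$, and suppose $l'\wedge l''=\{m,m+1,\dots,M\}$. For $l\in\{m,\dots,M\}$ put $p^l=P_{(l',c'),(l'',c'')}^{(l,c)}$, $\xi'(l)=\xi(l',c';l)$, $\xi''(l)=\xi(l'',c'';l)$, $s(l)=S_{c'(l),c''(l)}^{c(l)}$, and $\xi(\tilde l,l)=\xi(\tilde l,c;l)$. Let $\overrightarrow{P}=(p^m,p^{m+1},\dots,p^M)^T$, $\overrightarrow{S}=\big(\xi'(l)\xi''(l)s(l)\big)_{l=m,\dots,M}^T$, and let $R$ be the strictly lower triangular matrix with rows $l$ and columns $\tilde l$ indexed by $m,\dots,M$, with entries $R_{l,\tilde l}=\xi(\tilde l,l)$ for $\tilde l<l$ and $R_{l,\tilde l}=0$ for $\tilde l\ge l$. Then $$\overrightarrow{P}=(1+R)^{-1}\overrightarrow{S}.$$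
   Context: Admissible poset: a poset $\Lambda$ with a minimal element $0$ (so $0\preceq\lambda$ for all $\lambda$), such that $\{\lambda'\mid\lambda'\preceq\lambda\}$ is finite for each $\lambda$ and each finite subset has a supremum. The supremum of $\lambda',\lambda''$ is denoted $\lambda'\wedge\lambda''$. Let $G$ be a group acting on $\Lambda$ by order automorphisms, let $\mathrm{Sub}(G)$ be the poset of subgroups of $G$ (ordered by inclusion, $G$ acting by conjugation), and let $\eta:\Lambda\to\mathrm{Sub}(G)$, $\lambda\mapsto G_\lambda$, be order preserving and $G$-equivariant ($G_{g\lambda}=gG_\lambda g^{-1}$). Put $L=\Lambda/G$, with $l'\preceq l''$ iff $\lambda'\preceq\lambda''$ for some $\lambda'\in l',\lambda''\in l''$. For $l',l''\in L$, $l'\wedge l''\subset L$ is the set of orbits of all elements $\lambda'\wedge\lambda''$, $\lambda'\in l'$, $\lambda''\in l''$. $G_l$ denotes the conjugacy class of the subgroups $G_\lambda$, $\lambda\in l$ (or a representative of it). A partial element is a pair $(\lambda,h)$ with $\lambda\in\Lambda$, $h\in G_\lambda$; $G$ acts on partial elements by $g(\lambda,h)=(g\lambda,ghg^{-1})$ (conjugation), and orbits are called conjugacy classes of partial elements. $(\Lambda,G,\eta)$ is an admissible set of data if $\Lambda$ is admissible and: (1) $G_0=\{e\}$; (2) every $G_\lambda$ is finite; (3) $l'\wedge l''$ is a finite set for all $l',l''\in L$; (4) if $l'\wedge x=l''\wedge x$ for all $x\in L$ and $G_{l'}=G_{l''}$, then $l'=l''$; (5) for any $\lambda',\lambda''\preceq\lambda$,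 any two partial elements $(\lambda',h'),(\lambda'',h'')$ conjugated by an element of $G$ are conjugated by an element of $G_\lambda$. Standing assumptions: $G=\bigcup_\lambda G_\lambda$; each $G_\lambda$ maps $\{\mu\mid\mu\preceq\lambda\}$ to itself (equivalently, fixes $\lambda$); for each conjugacy class $c$ of $G$ and each $\lambda$, $c\cap G_\lambda$ is empty or a single conjugacy class of $G_\lambda$. For $l\in L$ and a conjugacy class $c$ of $G$, let $(l,c)=\{(\lambda,h)\mid\lambda\in l,\ h\in c\cap G_\lambda\}$; it is empty or a conjugacy class of partial elements, and every conjugacy class of partial elements has this form. Partial elements are multiplied by $(\lambda',h')(\lambda'',h'')=(\lambda'\wedge\lambda'',h'h'')$. $e_{(l,c)}$ is the formal sum of all elements of $(l,c)$ ($e_{(l,c)}=0$ if $(l,c)=\emptyset$). $A=A(\Lambda,G,\eta)$ is the $k$-vector space with basis the nonzero $e_{(l,c)}$, a commutative associative algebra under the multiplication induced by that of partial elements; $P_{\omega',\omega''}^{\omega}$ is the coefficient of $e_\omega$ in $e_{\omega'}e_{\omega''}$ (set to $0$ if any of $\omega,\omega',\omega''$ is empty). For $c$ meeting $G_\lambda$ ($\lambda\in l$), $c(l)=c(\lambda)=c\cap G_\lambda$, and $e_{c(l)}$ is the sum of its elements; these form a basis of $Z(k[G_l])$ (the center of $k[G_\lambda]$, $\lambda\in l$, canonically the same for all $\lambda\in l$). $S_{c'(l),c''(l)}^{c(l)}$ is the coefficient of $e_{c(l)}$ in $e_{c'(l)}e_{c''(l)}$, set to $0$ if any of $c,c',c''$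 does not meet $G_\lambda$. For $l',l\in L$, $\xi(l',c;l)$ is the number of $\lambda'\in l'$ with $\lambda'\preceq\lambda$ and $h\in G_{\lambda'}$, where $\lambda\in l$ and $h\in c\cap G_\lambda$ are fixed (independent of the choice; $0$ if $c\cap G_\lambda=\emptyset$). *)

(* Defs.v *)
From HB Require Import structures.
From mathcomp Require Import all_boot all_order all_algebra finmap.
From mathcomp Require Import boolp classical_sets functions cardinality fsbigop.

Set Implicit Arguments.
Unset Strict Implicit.
Unset Printing Implicit Defensive.

Import Order.TTheory GRing.Theory.

Local Open Scope classical_set_scope.
Local Open Scope ring_scope.

(* Formal, possibly infinite, linear combinations of the elements of T with    *)
(* coefficients in k are functions T -> k.                                     *)

(* The multiplication induced by [op]: the coefficient of t in x * y. The sum  *)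
(* ranges over the pairs with a nonzero contribution; it is only meaningful    *)
(* when there are finitely many of them, as is the case for the e_(l,c).       *)
Definition formal_mul (k : fieldType) (T : choiceType) (op : T -> T -> T)
    (x y : T -> k) : T -> k :=
  fun t => \sum_(p \in [set p : T * T | op p.1 p.2 = t]) x p.1 * y p.2.

(* e_X, the formal sum of all elements of X; e_set0 = 0. *)
Definition formal_sum (k : fieldType) (T : Type) (X : set T) : T -> k :=
  fun t => if `[< X t >] then 1 else 0.

(* The families a such that x is the finite linear combination                 *)
(* \sum_(X in B) a_X e_X of the basis (e_X)_(X in B).                          *)
Definition coordinates (k : fieldType) (T : Type) (B : set (set T))
    (x : T -> k) : set (set T -> k) :=
  [set a | [/\ finite_set [set X | a X != 0],
               (forall X, ~ B X -> a X = 0) &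
               forall t, x t = \sum_(X \in B) a X * formal_sum k X t]].

(* The coefficient of e_X in x; it is 0 when e_X is not in the basis.          *)
Definition coefficient (k : fieldType) (T : Type) (B : set (set T))
    (x : T -> k) (X : set T) : k :=
  xget (fun=> 0) (coordinates B x) X.

(* An order preserving, G-equivariant map from a G-poset to Sub(G). A poset    *)
(* in which every finite subset (including the empty one) has a supremum is a  *)
(* join-semilattice with bottom; the element 0 is \bot and the supremum,       *)
(* written with a wedge in the source, is the join.                            *)
Record group_data (d : Order.disp_t) (Lam : bJoinSemilatticeType d)
    (G : groupType) := GroupData {
  act : G -> Lam -> Lam;
  stab : Lam -> set G;
  act1 : forall x, act 1%g x = x;
  actM : forall g h x, act (g * h)%g x = act g (act h x);
  act_mono : forall g x y, (act g x <= act g y)%O = (x <= y)%O;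
  stab_group : forall x, group_closed (mem (stab x));
  stab_homo : forall x y, (x <= y)%O -> stab x `<=` stab y;
  stab_equivariant : forall g x,
    stab (act g x) = [set (g * h * g^-1)%g | h in stab x]
}.

Definition conj_class_of (G : groupType) (H : set G) (h : G) : set G :=
  [set (g * h * g^-1)%g | g in H].

Definition conj_classes (G : groupType) : set (set G) :=
  [set c | exists h, c = conj_class_of [set: G] h].

Arguments conj_classes G : clear implicits.

Definition orbit_of (d : Order.disp_t) (Lam : bJoinSemilatticeType d)
    (G : groupType) (D : group_data Lam G) (x : Lam) : set Lam :=
  [set act D g x | g in [set: G]].

(* L = Lam / G, an orbit being represented by its set of elements. *)
Definition orbits (d : Order.disp_t) (Lam : bJoinSemilatticeType d)
    (G : groupType) (D : group_data Lam G) : set (set Lam) :=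
  [set l | exists x, l = orbit_of D x].

Definition orbit_le (d : Order.disp_t) (Lam : bJoinSemilatticeType d)
    (l1 l2 : set Lam) : Prop :=
  exists x1 x2, [/\ l1 x1, l2 x2 & (x1 <= x2)%O].

Definition orbit_wedge (d : Order.disp_t) (Lam : bJoinSemilatticeType d)
    (G : groupType) (D : group_data Lam G) (l1 l2 : set Lam) :
    set (set Lam) :=
  [set orbit_of D (x1 `|` x2)%O | x1 in l1 & x2 in l2].

(* For an orbit l, this is a full conjugacy class of subgroups. *)
Definition orbit_stab (d : Order.disp_t) (Lam : bJoinSemilatticeType d)
    (G : groupType) (D : group_data Lam G) (l : set Lam) : set (set G) :=
  stab D @` l.

Definition partial_elts (d : Order.disp_t) (Lam : bJoinSemilatticeType d)
    (G : groupType) (D : group_data Lam G) : set (Lam * G) :=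
  [set p | stab D p.1 p.2].

Definition partial_act (d : Order.disp_t) (Lam : bJoinSemilatticeType d)
    (G : groupType) (D : group_data Lam G) (g : G) (p : Lam * G) : Lam * G :=
  (act D g p.1, (g * p.2 * g^-1)%g).

Definition partial_mul (d : Order.disp_t) (Lam : bJoinSemilatticeType d)
    (G : groupType) (p q : Lam * G) : Lam * G :=
  ((p.1 `|` q.1)%O, (p.2 * q.2)%g).

Definition partial_classes (d : Order.disp_t) (Lam : bJoinSemilatticeType d)
    (G : groupType) (D : group_data Lam G) : set (set (Lam * G)) :=
  [set X | exists2 p, partial_elts D p &
             X = [set partial_act D g p | g in [set: G]]].

Record admissible (d : Order.disp_t) (Lam : bJoinSemilatticeType d)
    (G : groupType) (D : group_data Lam G) : Prop := Admissible {
  finite_below : forall x : Lam, finite_set [set y : Lam | (y <= x)%O];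
  stab_bot : stab D \bot%O = [set 1%g];
  finite_stab : forall x, finite_set (stab D x);
  finite_wedge : forall l1 l2, orbits D l1 -> orbits D l2 ->
    finite_set (orbit_wedge D l1 l2);
  orbit_separated : forall l1 l2, orbits D l1 -> orbits D l2 ->
    (forall x, orbits D x -> orbit_wedge D l1 x = orbit_wedge D l2 x) ->
    orbit_stab D l1 = orbit_stab D l2 -> l1 = l2;
  partial_conj : forall x p q, (p.1 <= x)%O -> (q.1 <= x)%O ->
    partial_elts D p -> partial_elts D q ->
    (exists g, q = partial_act D g p) ->
    exists2 g, stab D x g & q = partial_act D g p
}.

Record standing (d : Order.disp_t) (Lam : bJoinSemilatticeType d)
    (G : groupType) (D : group_data Lam G) : Prop := Standing {
  stab_cover : \bigcup_(x in [set: Lam]) stab D x = [set: G];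
  stab_below : forall x g y, stab D x g -> (y <= x)%O -> (act D g y <= x)%O;
  conj_class_stab : forall c x, conj_classes G c ->
    c `&` stab D x = set0 \/
    exists2 h, stab D x h & c `&` stab D x = conj_class_of (stab D x) h
}.

(* (l,c) *)
Definition partial_class (d : Order.disp_t) (Lam : bJoinSemilatticeType d)
    (G : groupType) (D : group_data Lam G) (l : set Lam) (c : set G) :
    set (Lam * G) :=
  [set p | [/\ l p.1, c p.2 & stab D p.1 p.2]].

(* The e_X with X in this set form the basis of the algebra A. *)
Definition A_basis (d : Order.disp_t) (Lam : bJoinSemilatticeType d)
    (G : groupType) (D : group_data Lam G) : set (set (Lam * G)) :=
  [set X | X !=set0 /\ exists l c,
     [/\ orbits D l, conj_classes G c & X = partial_class D l c]].

(* The structure constants of A; the value is 0 as soon as one of the          *)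
(* classes is empty, since e_set0 = 0 and set0 is not in A_basis.              *)
Definition Pcoef (k : fieldType) (d : Order.disp_t)
    (Lam : bJoinSemilatticeType d) (G : groupType) (D : group_data Lam G)
    (w1 w2 w : set (Lam * G)) : k :=
  coefficient (A_basis D)
    (formal_mul (@partial_mul d Lam G) (formal_sum k w1) (formal_sum k w2)) w.

Definition orbit_repr (d : Order.disp_t) (Lam : bJoinSemilatticeType d)
    (l : set Lam) : Lam := xget \bot%O l.

(* c(x) = c :&: G_x *)
Definition class_at (d : Order.disp_t) (Lam : bJoinSemilatticeType d)
    (G : groupType) (D : group_data Lam G) (c : set G) (x : Lam) : set G :=
  c `&` stab D x.

(* The e_X with X in this set form the basis of the center of k[G_x]. *)
Definition Z_basis (d : Order.disp_t) (Lam : bJoinSemilatticeType d)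
    (G : groupType) (D : group_data Lam G) (x : Lam) : set (set G) :=
  [set X | X !=set0 /\ exists2 c, conj_classes G c & X = class_at D c x].

(* The structure constants of the center of k[G_x], x in l; the value is 0     *)
(* when c1, c2 or c does not meet G_x, as for Pcoef. Elements of k[G_x] are    *)
(* seen as functions on G vanishing outside of G_x.                            *)
Definition Scoef (k : fieldType) (d : Order.disp_t)
    (Lam : bJoinSemilatticeType d) (G : groupType) (D : group_data Lam G)
    (c1 c2 c : set G) (l : set Lam) : k :=
  let x := orbit_repr l in
  coefficient (Z_basis D x)
    (formal_mul (fun g h : G => (g * h)%g)
       (formal_sum k (class_at D c1 x)) (formal_sum k (class_at D c2 x)))
    (class_at D c x).

Definition xi (d : Order.disp_t) (Lam : bJoinSemilatticeType d)
    (G : groupType) (D : group_data Lam G)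
    (l1 : set Lam) (c : set G) (l : set Lam) : nat :=
  let x := orbit_repr l in
  let h := xget 1%g (class_at D c x) in
  if `[< class_at D c x !=set0 >]
  then #|` fset_set [set y | [/\ l1 y, (y <= x)%O & stab D y h]]|%fset
  else 0%N.

(* An identification, as ordered sets, of L with the natural numbers. *)
Definition orbit_iso (d : Order.disp_t) (Lam : bJoinSemilatticeType d)
    (G : groupType) (D : group_data Lam G) (orb : nat -> set Lam) : Prop :=
  set_bij [set: nat] (orbits D) orb /\
  forall i j, orbit_le (orb i) (orb j) <-> (i <= j)%N.

(* Main.v *)
(* Fix a level l, a representative x of it and h in the intersection of c and G_x (if it is
   empty, the l-th entries of S, P and R P vanish), and count the
   pairs (x', h'), (x'', h'') of elements of (l', c') and (l'', c'') with x' <= x,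
   x'' <= x and h' h'' = h.  For given h', h'' there are xi'(l) xi''(l) choices of
   (x', x''), which gives xi'(l) xi''(l) s(l).  Grouping instead by the join y of
   x' and x'', each y in the orbit j accounts for p^j pairs, and there are
   xi(j, l) such y; hence the sum over j of xi(j, l) p^j.  Finally xi(l, l) = 1,
   and xi(j, l) = 0 for j > l, so this is (1 + R) P = S. *)
Require Import Defs.
From mathcomp Require Import all_boot all_order all_algebra finmap.
From mathcomp Require Import boolp classical_sets functions cardinality fsbigop.
Import Order.TTheory GRing.Theory.
Local Open Scope classical_set_scope.
Local Open Scope ring_scope.

Set Implicit Arguments.
Unset Strict Implicit.
Unset Printing Implicit Defensive.

(** * Counting in the field [k] *)

(* The cardinal of [A] read in [k]; it is 0 when [A] is infinite. *)
Definition cardk (k : fieldType) (T : choiceType) (A : set T) : k :=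
  \sum_(x \in A) (1 : k).

Lemma cardk_fset_set (k : fieldType) (T : choiceType) (A : set T) :
  finite_set A -> cardk k A = (#|` fset_set A|%fset)%:R.
Proof.
move=> finA; rewrite /cardk fsbig_finite //= big_const_seq count_predT.
by rewrite -[RHS]/(1 *+ _) iter_addr_0.
Qed.

Lemma cardk_bij (k : fieldType) (T U : choiceType) (f : T -> U)
    (A : set T) (B : set U) :
  set_bij A B f -> cardk k A = cardk k B.
Proof. by move=> bijf; rewrite /cardk (reindex_fsbig f A B). Qed.

Lemma cardk_setX (k : fieldType) (T U : choiceType) (A : set T) (B : set U) :
  finite_set A -> finite_set B ->
  cardk k (A `*` B) = cardk k A * cardk k B.
Proof.
move=> finA finB; rewrite /cardk mulr_fsuml.
rewrite -(pair_fsbig _ (fun=> fun=> 1)) //.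
by apply: eq_fsbigr => x _; rewrite mul1r.
Qed.

(** Each element of [A] lies over exactly one element of [B], so it suffices to exchange two finite
    sums of indicators. *)
Lemma cardk_fibers (k : fieldType) (T U : choiceType) (f : T -> U)
    (A : set T) (B : set U) :
  finite_set A -> finite_set B -> (forall x, A x -> B (f x)) ->
  cardk k A = \sum_(y \in B) cardk k (A `&` [set x | f x = y]).
Proof.
move=> finA finB AB; under eq_fsbigr do rewrite /cardk fsbig_mkcondr.
rewrite exchange_fsbig //; apply: eq_fsbigr => x /[1!inE] Ax.
rewrite -(fsbig_widen [set f x] B) ?fsbig_set1 /=.
- by rewrite mem_set.
- by move=> _ ->; apply: AB.
- by move=> y [_ neqy]; rewrite /preimage /= memNset //= => /esym.
Qed.

Lemma cardk_neq0 (k : fieldType) (T : choiceType) (A : set T) :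
  cardk k A != 0 -> A !=set0.
Proof.
apply: contraNP => /set0P/negP; rewrite negbK => /eqP ->.
by rewrite /cardk fsbig_set0.
Qed.

(** * Formal sums and their coefficients *)

Lemma formal_mul_sum (k : fieldType) (T : choiceType) (op : T -> T -> T)
    (X Y : set T) (t : T) :
  formal_mul op (formal_sum k X) (formal_sum k Y) t =
  cardk k [set p | [/\ X p.1, Y p.2 & op p.1 p.2 = t]].
Proof.
rewrite /formal_mul /cardk.
rewrite (_ : [set p | [/\ X p.1, Y p.2 & op p.1 p.2 = t]] =
  [set p | op p.1 p.2 = t] `&` [set p | X p.1 /\ Y p.2]); last first.
  by apply/seteqP; split=> p /= => [[]|[? []]].
rewrite fsbig_mkcondr; apply: eq_fsbigr => p _; rewrite /formal_sum.
case: asboolP => Xp; case: asboolP => Yp; case: ifPn;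
  rewrite ?inE ?notin_setE /=.
all: by rewrite ?mulr1 ?mul0r ?mulr0 //; tauto.
Qed.

(** Since the sets of [B] are pairwise disjoint, any expansion of [x] evaluated at [t] reduces to
    its coordinate at [X]. The other hypotheses on [x] ensure that an expansion exists; otherwise
    [coefficient] would return its default 0. *)
Lemma coefficientE (k : fieldType) (T : Type) (B : set (set T)) (x : T -> k)
    (X : set T) (t : T) :
  (forall Y Z s, B Y -> B Z -> Y s -> Z s -> Y = Z) ->
  (forall Y s u, B Y -> Y s -> Y u -> x s = x u) ->
  (forall s, x s != 0 -> exists2 Y, B Y & Y s) ->
  finite_set [set Y | B Y /\ exists2 s, Y s & x s != 0] ->
  B X -> X t -> coefficient B x X = x t.
Proof.
move=> disj const cover fin BX Xt.
have expand (a : set T -> k) Y s : B Y -> Y s ->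
    \sum_(Z \in B) a Z * formal_sum k Z s = a Y.
  move=> BY Ys; rewrite -(fsbig_widen [set Y]) ?fsbig_set1.
  - by rewrite /formal_sum asboolT // mulr1.
  - by move=> _ ->.
  - move=> Z [BZ /= neqZ]; rewrite /formal_sum.
    case: asboolP; last by rewrite mulr0.
    by move=> Zs; case: neqZ; apply: (disj _ _ s).
rewrite /coefficient; case: xgetP => [a _ [_ _ ->]|noa].
  by rewrite (expand _ X).
(* The coordinate at [Y] is the common value of [x] on [Y]; it is set to 0 when [Y] is empty or
   outside [B]. *)
have pickP Y : {v : k | if `[< B Y /\ exists s, Y s >] then
   (exists2 s, Y s & v = x s) else v = 0}.
  apply: cid; case: asboolP => [[_ [s Ys]]|_]; last by exists 0.
  by exists (x s), s.
pose a Y := sval (pickP Y).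
have aE Y s : B Y -> Y s -> a Y = x s.
  move=> BY Ys; rewrite /a; case: (pickP Y) => v /=.
  rewrite asboolT; last by split=> //; exists s.
  by move=> [u Yu ->]; apply: (const Y).
have a0 Y : ~ (B Y /\ exists s, Y s) -> a Y = 0.
  by move=> nBY; rewrite /a; case: (pickP Y) => v /=; rewrite asboolF.
case: (noa a); split.
- apply: sub_finite_set fin => Y /= aY0.
  have [[BY [s Ys]]|/a0] := pselect (B Y /\ exists s, Y s);
    last by move/eqP: aY0.
  by split=> //; exists s => //; rewrite -(aE Y).
- by move=> Y nBY; apply: a0 => -[].
- move=> s; have [[Y BY Ys]|noY] := pselect (exists2 Y, B Y & Y s).
    by rewrite (expand _ Y) // (aE Y s).
  (* Outside the union of [B] every term is 0, and so is [x s] by the covering hypothesis. *)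
  rewrite fsbig1; first by have [//|/cover/noY] := eqVneq (x s) 0.
  move=> Y BY; rewrite /formal_sum asboolF ?mulr0 // => Ys.
  by apply: noY; exists Y.
Qed.

Lemma coefficient_notin (k : fieldType) (T : Type) (B : set (set T))
    (v : T -> k) (X : set T) : ~ B X -> coefficient B v X = 0.
Proof.
by rewrite /coefficient; case: xgetP => // a _ [_ a0 _] /a0.
Qed.

Lemma coefficient_set0 (k : fieldType) (T : Type) (B : set (set T))
    (v : T -> k) : (forall X, B X -> X !=set0) -> coefficient B v set0 = 0.
Proof. by move=> Bn0; apply: coefficient_notin => /Bn0[]. Qed.

(** * The action of [G], orbits and conjugacy classes *)

Section AdmissibleData.
Variables (d : Order.disp_t) (Lam : bJoinSemilatticeType d) (G : groupType).
Variable D : group_data Lam G.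
Hypotheses (adm : admissible D) (std : standing D).

Implicit Types (x y : Lam) (g h : G) (l : set Lam) (c : set G).

Lemma conj_mul g h1 h2 :
  (g * (h1 * h2) * g^-1 = (g * h1 * g^-1) * (g * h2 * g^-1))%g.
Proof. by rewrite !mulgA mulgVK. Qed.

Lemma conj_inv g h : (g^-1 * (g * h * g^-1) * g^-1^-1 = h)%g.
Proof. by rewrite invgK !mulgA mulVg mul1g mulgVK. Qed.

Lemma stab_mul x g h : stab D x g -> stab D x h -> stab D x (g * h)%g.
Proof.
by have := group_closedM (stab_group D x) => /(_ g h); rewrite !inE.
Qed.

Lemma stab_inv x g : stab D x g -> stab D x g^-1%g.
Proof.
by have := group_closedV (stab_group D x) => /(_ g); rewrite !inE.
Qed.

Lemma actK g : cancel (act D g) (act D g^-1%g).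
Proof. by move=> x; rewrite -actM mulVg act1. Qed.

Lemma actVK g : cancel (act D g^-1%g) (act D g).
Proof. by move=> x; rewrite -actM mulgV act1. Qed.

Lemma act_join g x y : act D g (x `|` y)%O = (act D g x `|` act D g y)%O.
Proof.
apply/eqP; rewrite eq_le leUx !act_mono leUl leUr /= andbT.
rewrite -(act_mono D g^-1%g) actK leUx -{1}(actK g x) -{2}(actK g y).
by rewrite !act_mono leUl leUr.
Qed.

(* The injection [act D g] of the finite set [{y | y <= x}] into itself is onto. *)
Lemma act_le_id g x : (act D g x <= x)%O -> act D g x = x.
Proof.
move=> gx_le; have fin := finite_below adm x.
pose F := fset_set [set y | (y <= x)%O].
have inF y : (y \in F) = (y <= x)%O.
  by rewrite /F in_fset_set //; apply/idP/idP; rewrite inE.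
have sub : ([fset act D g y | y in F] `<=` F)%fset.
  apply/fsubsetP => _ /imfsetP[y /= yF ->]; rewrite inF.
  by apply: le_trans gx_le; rewrite act_mono -inF.
have: [fset act D g y | y in F]%fset == F.
  rewrite eqEfcard sub card_imfset //= => u v.
  exact: (can_inj (actK g)).
move=> /eqP/fsetP/(_ x); rewrite inF lexx => /imfsetP[y /= yF x_eq].
apply/eqP; rewrite eq_le gx_le /= {1}x_eq act_mono.
by rewrite -inF.
Qed.

(** The standing assumption only gives [act D g x <= x]; finiteness below [x], through [act_le_id],
    turns this into an equality. *)
Lemma stab_fix x g : stab D x g -> act D g x = x.
Proof. by move=> xg; apply/act_le_id/(stab_below std xg). Qed.

Lemma stab_act g x h : stab D x h -> stab D (act D g x) (g * h * g^-1)%g.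
Proof. by move=> xh; rewrite stab_equivariant; exists h. Qed.

Lemma orbits_act l g x : orbits D l -> l x -> l (act D g x).
Proof. by move=> [y ->] [h _ <-]; exists (g * h)%g => //; rewrite actM. Qed.

Lemma orbits_trans l x y : orbits D l -> l x -> l y -> exists g, y = act D g x.
Proof.
by move=> [z ->] [g _ <-] [h _ <-]; exists (h * g^-1)%g; rewrite actM actK.
Qed.

Lemma orbit_of_self x : orbit_of D x x.
Proof. by exists 1%g => //; rewrite act1. Qed.

Lemma orbitsE l x : orbits D l -> l x -> l = orbit_of D x.
Proof.
move=> Ol lx; apply/seteqP; split=> [y /(orbits_trans Ol lx)[g ->]|_ [g _ <-]].
  by exists g.
exact: orbits_act.
Qed.

Lemma orbit_repr_in l : orbits D l -> l (orbit_repr l).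
Proof. by move=> [x ->]; apply: xgetPex; exists x; exact: orbit_of_self. Qed.

Lemma class_conj c g h : conj_classes G c -> c h -> c (g * h * g^-1)%g.
Proof.
by move=> [h0 ->] [g0 _ <-]; exists (g * g0)%g => //; rewrite invgM !mulgA.
Qed.

Lemma conj_class_self h : conj_class_of [set: G] h h.
Proof. by exists 1%g => //; rewrite mul1g invg1 mulg1. Qed.

Lemma conj_classesE c h :
  conj_classes G c -> c h -> c = conj_class_of [set: G] h.
Proof.
move=> Cc ch; apply/seteqP; split=> [h'|_ [g _ <-]]; last exact: class_conj.
move: Cc ch => [h0 ->] [g0 _ <-] [g1 _ <-]; exists (g1 * g0^-1)%g => //.
by rewrite invgM invgK !mulgA !(mulgVK, mulgK).
Qed.

Lemma class_at_conj c x h1 h2 : conj_classes G c ->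
  class_at D c x h1 -> class_at D c x h2 ->
  exists2 g, stab D x g & h2 = (g * h1 * g^-1)%g.
Proof.
move=> Cc; rewrite /class_at.
have [->//|[h xh ->]] := conj_class_stab std x Cc.
move=> [g1 xg1 <-] [g2 xg2 <-]; exists (g2 * g1^-1)%g.
  by apply: stab_mul => //; apply: stab_inv.
by rewrite invgM invgK !mulgA !(mulgVK, mulgK).
Qed.

Lemma partial_class_act l c g p : orbits D l -> conj_classes G c ->
  partial_class D l c p -> partial_class D l c (partial_act D g p).
Proof.
move=> Ol Cc [lp cp sp].
by split; [exact: orbits_act | exact: class_conj | exact: stab_act].
Qed.

(** First move [x] to [y] within the orbit [l]; then match the group components by an element of
    [stab D y], which fixes [y]. *)
Lemma partial_class_conj l c p q : orbits D l -> conj_classes G c ->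
  partial_class D l c p -> partial_class D l c q ->
  exists g, q = partial_act D g p.
Proof.
case: p q => [x h1] [y h2] Ol Cc pp [/= ly ch2 yh2].
have [g yE] := orbits_trans Ol (let: And3 lx _ _ := pp in lx) ly.
have [_ /= cgh xgh] := partial_class_act g Ol Cc pp.
move: cgh xgh; rewrite /= -yE => cgh ygh.
have [g' yg' ->] := class_at_conj Cc (conj cgh ygh) (conj ch2 yh2).
exists (g' * g)%g; rewrite /partial_act /= actM -yE (stab_fix yg').
by rewrite invgM !mulgA.
Qed.

Lemma partial_actM g p q : partial_act D g (partial_mul p q) =
  partial_mul (partial_act D g p) (partial_act D g q).
Proof. by rewrite /partial_act /partial_mul /= act_join conj_mul. Qed.

Lemma partial_actK g : cancel (partial_act D g) (partial_act D g^-1%g).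
Proof. by move=> [x h]; rewrite /partial_act /= actK conj_inv. Qed.

Lemma partial_class_disjoint l1 c1 l2 c2 p :
  orbits D l1 -> conj_classes G c1 -> orbits D l2 -> conj_classes G c2 ->
  partial_class D l1 c1 p -> partial_class D l2 c2 p -> l1 = l2 /\ c1 = c2.
Proof.
move=> O1 C1 O2 C2 [lp1 cp1 _] [lp2 cp2 _].
rewrite (orbitsE O1 lp1) (orbitsE O2 lp2).
by rewrite (conj_classesE C1 cp1) (conj_classesE C2 cp2).
Qed.

(** * Structure constants as numbers of factorizations *)

Definition factors (w1 w2 : set (Lam * G)) (t : Lam * G) :
    set ((Lam * G) * (Lam * G)) :=
  [set p | [/\ w1 p.1, w2 p.2 & partial_mul p.1 p.2 = t]].

(** Acting by [g] on both factors is a bijection between the two sets of factorizations. Hence a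
    product of two formal sums is constant on each class, as [coefficientE] requires. *)
Lemma factors_act l1 c1 l2 c2 g t (k : fieldType) :
  orbits D l1 -> conj_classes G c1 -> orbits D l2 -> conj_classes G c2 ->
  let w1 := partial_class D l1 c1 in let w2 := partial_class D l2 c2 in
  cardk k (factors w1 w2 t) = cardk k (factors w1 w2 (partial_act D g t)).
Proof.
move=> O1 C1 O2 C2 w1 w2.
pose f g (p : (Lam * G) * (Lam * G)) :=
  (partial_act D g p.1, partial_act D g p.2).
have fK g1 : cancel (f g1) (f g1^-1%g).
  by move=> [p q]; rewrite /f !partial_actK.
apply: (@cardk_bij _ _ _ (f g)); split.
- move=> p [w1p w2p <-]; split; rewrite ?partial_actM //;
    exact: partial_class_act.
- by apply: in2W; apply: can_inj (fK g).
- move=> [p q] [/= w1p w2q pq]; exists (f g^-1%g (p, q)).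
    split; rewrite /f /=; try exact: partial_class_act.
    by rewrite -partial_actM pq partial_actK.
  by have := fK g^-1%g (p, q); rewrite invgK.
Qed.

Lemma PcoefE (k : fieldType) l1 c1 l2 c2 l c t :
  orbits D l1 -> conj_classes G c1 -> orbits D l2 -> conj_classes G c2 ->
  orbits D l -> conj_classes G c -> partial_class D l c t ->
  Pcoef k D (partial_class D l1 c1) (partial_class D l2 c2)
    (partial_class D l c)
  = cardk k (factors (partial_class D l1 c1) (partial_class D l2 c2) t).
Proof.
move=> O1 C1 O2 C2 Ol Cc tin; rewrite -formal_mul_sum /Pcoef.
(* The support of the product: the groups of both factors are contained in the group of their
   join. *)
have factor_in s :
    formal_mul (@partial_mul d Lam G) (formal_sum k (partial_class D l1 c1))
      (formal_sum k (partial_class D l2 c2)) s != 0 ->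
    stab D s.1 s.2 /\ orbit_wedge D l1 l2 (orbit_of D s.1).
  rewrite formal_mul_sum => /cardk_neq0[[p q] [[lp cp sp] [lq cq sq] <-]] /=.
  split; last by exists p.1 => //; exists q.1.
  by apply: stab_mul;
    [apply: stab_homo sp; rewrite leUl | apply: stab_homo sq; rewrite leUr].
apply: coefficientE => //.
- move=> _ _ s [_ [l3 [c3 [O3 C3 ->]]]] [_ [l4 [c4 [O4 C4 ->]]]] s3 s4.
  by have [-> ->] := partial_class_disjoint O3 C3 O4 C4 s3 s4.
- move=> _ s u [_ [l3 [c3 [O3 C3 ->]]]] s3 u3.
  have [g ->] := partial_class_conj O3 C3 s3 u3.
  by rewrite !formal_mul_sum; apply: factors_act.
- move=> s /factor_in[ss _].
  have s_in : partial_class D (orbit_of D s.1) (conj_class_of [set: G] s.2) s.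
    by split; [exact: orbit_of_self | exact: conj_class_self |].
  exists (partial_class D (orbit_of D s.1) (conj_class_of [set: G] s.2)) => //.
  split; first by exists s.
  exists (orbit_of D s.1), (conj_class_of [set: G] s.2); split=> //.
    by exists s.1.
  by exists s.2.
(* Finiteness: a class that occurs lies over one of the finitely many orbits in
   [orbit_wedge D l1 l2], and it is determined by an element of the finite group at the
   representative of that orbit. *)
- pose F (q : set Lam * G) := partial_class D q.1 (conj_class_of [set: G] q.2).
  apply: (@sub_finite_set _ _
    (F @` (orbit_wedge D l1 l2 `*`` (fun l3 => stab D (orbit_repr l3))))).
    move=> _ [[_ [l3 [c3 [O3 C3 ->]]]] [s s3 /factor_in[_ ws]]].
    have [ls _ _] := s3.
    have [g xE] := orbits_trans O3 ls (orbit_repr_in O3).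
    have [_ cg] := partial_class_act g O3 C3 s3; rewrite /= -xE => sg.
    exists (l3, (g * s.2 * g^-1)%g) => /=; first by rewrite {1}(orbitsE O3 ls).
    by rewrite /F /= -(conj_classesE C3 cg).
  apply: finite_image; apply: finite_setXR; first exact: finite_wedge.
  by move=> l3 _; apply: finite_stab.
- by split; [exists t | exists l, c].
Qed.

Lemma class_at_actE c x g h : conj_classes G c -> stab D x g ->
  class_at D c x h -> class_at D c x (g * h * g^-1)%g.
Proof.
move=> Cc xg [ch xh]; split; first exact: class_conj.
by rewrite -(stab_fix xg); apply: stab_act.
Qed.

(** The argument of [PcoefE] inside a single group, with conjugation by [stab D x] in place of the
    action of [G]. *)
Lemma ScoefE (k : fieldType) c1 c2 c l h :
  conj_classes G c1 -> conj_classes G c2 -> conj_classes G c ->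
  class_at D c (orbit_repr l) h ->
  Scoef k D c1 c2 c l =
  cardk k [set p | [/\ class_at D c1 (orbit_repr l) p.1,
                       class_at D c2 (orbit_repr l) p.2 & (p.1 * p.2)%g = h]].
Proof.
move=> C1 C2 Cc hin.
rewrite -(formal_mul_sum _ (fun g h : G => (g * h)%g)) /Scoef.
move: (orbit_repr l) hin => x hin.
have factor_in s : formal_mul (fun g h : G => (g * h)%g)
    (formal_sum k (class_at D c1 x)) (formal_sum k (class_at D c2 x)) s != 0 ->
    stab D x s.
  rewrite formal_mul_sum => /cardk_neq0[p [[_ p1] [_ p2] <-]].
  exact: stab_mul.
apply: coefficientE => //.
- move=> _ _ s [_ [c3 C3 ->]] [_ [c4 C4 ->]] [s3 _] [s4 _].
  by rewrite (conj_classesE C3 s3) (conj_classesE C4 s4).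
- move=> _ s u [_ [c3 C3 ->]] s3 u3.
  have [g xg ->] := class_at_conj C3 s3 u3; rewrite !formal_mul_sum.
  pose f g (p : G * G) := ((g * p.1 * g^-1)%g, (g * p.2 * g^-1)%g).
  have fK g1 : cancel (f g1) (f g1^-1%g).
    by move=> [p q]; rewrite /f /= !conj_inv.
  apply: (@cardk_bij _ _ _ (f g)); split.
  + move=> p [p1 p2 <-]; split; rewrite /f /= -?conj_mul //;
      exact: class_at_actE.
  + by apply: in2W; apply: can_inj (fK g).
  + move=> p [p1 p2 pE]; exists (f g^-1%g p).
      have xg' := stab_inv xg.
      split; rewrite /f /=; try exact: class_at_actE.
      by rewrite -conj_mul pE conj_inv.
    by have := fK g^-1%g p; rewrite invgK.
- move=> s /factor_in xs.
  have s_in : class_at D (conj_class_of [set: G] s) x s.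
    by split=> //; exact: conj_class_self.
  exists (class_at D (conj_class_of [set: G] s) x) => //.
  split; first by exists s.
  by exists (conj_class_of [set: G] s) => //; exists s.
- apply: (@sub_finite_set _ _
    ((fun s => class_at D (conj_class_of [set: G] s) x) @` stab D x)).
    move=> _ [[_ [c3 C3 ->]] [s [c3s xs] _]].
    by exists s => //=; rewrite -(conj_classesE C3 c3s).
  exact/finite_image/finite_stab.
- by split; [exists h | exists c].
Qed.

(** * The numbers [xi] *)

Definition below_with l1 x h : set Lam :=
  [set y | [/\ l1 y, (y <= x)%O & stab D y h]].

Lemma finite_below_with l1 x h : finite_set (below_with l1 x h).
Proof. by apply: sub_finite_set (finite_below adm x) => y []. Qed.

(** The element chosen by [xi] is conjugate to [h] by some [g] in [stab D x]. As [g] fixes [x],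
    [act D g] is a bijection between the sets counted for the two elements. *)
Lemma xiE (k : fieldType) l1 c l h : orbits D l1 -> conj_classes G c ->
  class_at D c (orbit_repr l) h ->
  (xi D l1 c l)%:R = cardk k (below_with l1 (orbit_repr l) h).
Proof.
move=> O1 Cc; rewrite /xi; move: (orbit_repr l) => x xh.
have ne : class_at D c x !=set0 by exists h.
rewrite asboolT // -cardk_fset_set; last exact: finite_below_with.
have [g xg ->] := class_at_conj Cc (xgetPex 1%g ne) xh.
move: (xget _ _) => h0; apply: (@cardk_bij _ _ _ (act D g)); split.
- move=> y [l1y yx yh]; split; [exact: orbits_act | | exact: stab_act].
  by rewrite -(stab_fix xg) act_mono.
- by apply: in2W; apply: can_inj (actK g).
- move=> y [l1y yx yh]; exists (act D g^-1%g y); last exact: actVK.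
  split; first exact: orbits_act.
    by rewrite -(act_mono D g) actVK (stab_fix xg).
  by rewrite -(conj_inv g h0); apply: stab_act.
Qed.

Lemma xi_class_empty l1 c l : ~ (class_at D c (orbit_repr l) !=set0) ->
  xi D l1 c l = 0%N.
Proof. by move=> ne; rewrite /xi asboolF. Qed.

(** By [act_le_id], the only element of the orbit of [x] below [x] is [x] itself. This identifies
    the diagonal of 1 + R with the numbers xi(l, l). *)
Lemma xi_self (k : fieldType) c l : orbits D l -> conj_classes G c ->
  class_at D c (orbit_repr l) !=set0 -> (xi D l c l)%:R = 1 :> k.
Proof.
move=> Ol Cc [h xh]; rewrite (xiE _ Ol Cc xh).
rewrite (_ : below_with _ _ _ = [set orbit_repr l]).
  by rewrite /cardk fsbig_set1.
apply/seteqP; split=> y.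
  move=> [ly + _]; have [g ->] := orbits_trans Ol (orbit_repr_in Ol) ly.
  exact: act_le_id.
by move=> ->; case: xh => ? ?; split=> //; exact: orbit_repr_in.
Qed.

(** Provides the zeros of 1 + R above the diagonal. *)
Lemma xi_not_le l1 c l : orbits D l -> ~ orbit_le l1 l -> xi D l1 c l = 0%N.
Proof.
move=> Ol nle; rewrite /xi; case: ifP => // _.
rewrite (_ : [set y | _] = set0) ?fset_set0 ?cardfs0 //.
apply/seteqP; split=> // y [ly yx _]; apply: nle.
by exists y, (orbit_repr l); split=> //; exact: orbit_repr_in.
Qed.

(** * The double counting *)

(* Both sides count the pairs of factors lying below [orbit_repr l] whose group
   components multiply to [h]: on the left by group components, on the right by
   the join of the components in [Lam]. *)
Lemma xi_mul_Scoef (k : fieldType) l1 c1 l2 c2 l c h :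
  orbits D l1 -> conj_classes G c1 -> orbits D l2 -> conj_classes G c2 ->
  conj_classes G c -> class_at D c (orbit_repr l) h ->
  (xi D l1 c1 l)%:R * (xi D l2 c2 l)%:R * Scoef k D c1 c2 c l =
  \sum_(y \in [set y | (y <= orbit_repr l)%O /\ stab D y h])
     cardk k (factors (partial_class D l1 c1) (partial_class D l2 c2) (y, h)).
Proof.
move=> O1 C1 O2 C2 Cc xh; rewrite (ScoefE _ C1 C2 Cc xh).
have xi1 := xiE k O1 C1; have xi2 := xiE k O2 C2; move: (xi1 l) (xi2 l).
move: (xi D l1 c1 l) (xi D l2 c2 l) => n1 n2.
move: (orbit_repr l) xh => x xh {}xi1 {}xi2.
pose A : set ((Lam * G) * (Lam * G)) :=
  [set p | [/\ partial_class D l1 c1 p.1, partial_class D l2 c2 p.2,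
               (p.1.1 <= x)%O, (p.2.1 <= x)%O & (p.1.2 * p.2.2)%g = h]].
(* All components range over finite sets, because [stab D y] is contained in [stab D x] when
   [y <= x]. *)
have finA : finite_set A.
  have finx := finite_setX (finite_below adm x) (finite_stab adm x).
  apply: sub_finite_set (finite_setX finx finx).
  by move=> p [[_ _ s1] [_ _ s2] px qx _]; split; split=> //=;
    [apply: stab_homo s1 | apply: stab_homo s2].
set B := [set p | _].
have finB : finite_set B.
  apply: sub_finite_set (finite_setX (finite_stab adm x) (finite_stab adm x)).
  by move=> p [[_ ?] [_ ?] _].
transitivity (cardk k A).
  (* The fiber over [(h1, h2)] is a product of two [below_with] sets, whose cardinals do not depend
     on [h1] and [h2] by [xiE]. *)
  rewrite (@cardk_fibers _ _ _ (fun p => (p.1.2, p.2.2)) _ B) //; last first.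
    move=> p [[_ cp sp] [_ cq sq] px qx pq]; split=> //=.
      by split=> //; apply: stab_homo sp.
    by split=> //; apply: stab_homo sq.
  rewrite /cardk mulr_fsumr.
  apply: eq_fsbigr => -[h1 h2] /[1!inE] -[/= B1 B2 B12].
  rewrite mulr1 (xi1 _ B1) (xi2 _ B2).
  rewrite -cardk_setX; try exact: finite_below_with.
  apply: (@cardk_bij _ _ _ (fun p => ((p.1, h1), (p.2, h2)))); split.
  - move=> [y1 y2] [/= [l1y y1x y1h] [l2y y2x y2h]].
    by case: B1 => ? _; case: B2 => ? _.
  - by move=> [y1 y2] [z1 z2] _ _ [-> ->].
  - move=> [[y1 g1] [y2 g2]] /=.
    move=> [[[/= l1y c1y s1] [/= l2y c2y s2] /= y1x y2x _]] [g1E g2E].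
    by rewrite -g1E -g2E; exists (y1, y2).
(* Once the join is a fixed [y <= x], both bounds by [x] are automatic, so the fiber consists of all
   factorizations of [(y, h)]. *)
rewrite (@cardk_fibers _ _ _ (fun p => (p.1.1 `|` p.2.1)%O) _
  [set y | (y <= x)%O /\ stab D y h]) //.
- apply: eq_fsbigr => y /[1!inE] -[yx yh].
  congr cardk; apply/seteqP; split=> p.
    by move=> [[p1 p2 _ _ pq] /= yE]; split=> //; rewrite /partial_mul yE pq.
  move=> [p1 p2 [yE pq]]; split=> //; split=> //.
    by apply: le_trans yx; rewrite -yE leUl.
  by apply: le_trans yx; rewrite -yE leUr.
- by apply: sub_finite_set (finite_below adm x) => y [].
- move=> p [[_ _ s1] [_ _ s2] px qx <-] /=; rewrite leUx px qx; split=> //.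
  by apply: stab_mul;
    [apply: stab_homo s1; rewrite leUl | apply: stab_homo s2; rewrite leUr].
Qed.

End AdmissibleData.

(** * The linear system (1 + R) P = S *)

Theorem lemma5p3 (k : fieldType) (d : Order.disp_t)
    (Lam : bJoinSemilatticeType d) (G : groupType) (D : group_data Lam G)
    (adm : admissible D) (std : standing D)
    (orb : nat -> set Lam) (iso : orbit_iso D orb)
    (l' l'' : nat) (c' c'' c : set G)
    (hc' : conj_classes G c') (hc'' : conj_classes G c'')
    (hc : conj_classes G c)
    (hlc' : partial_classes D (partial_class D (orb l') c'))
    (hlc'' : partial_classes D (partial_class D (orb l'') c''))
    (m M : nat)
    (hwedge : orbit_wedge D (orb l') (orb l'') =
              [set orb l | l in [set l | (m <= l <= M)%N]]) :
  let lev (i : 'I_(M - m).+1) : set Lam := orb (m + i)%N in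
  let P : 'cV[k]_(M - m).+1 :=
    \col_i Pcoef k D (partial_class D (orb l') c')
                     (partial_class D (orb l'') c'')
                     (partial_class D (lev i) c) in
  let S : 'cV[k]_(M - m).+1 :=
    \col_i ((xi D (orb l') c' (lev i))%:R * (xi D (orb l'') c'' (lev i))%:R *
            Scoef k D c' c'' c (lev i)) in
  let R : 'M[k]_((M - m).+1) :=
    \matrix_(i, j) (if (j < i)%N then (xi D (lev j) c (lev i))%:R else 0) in
  P = invmx (1%:M + R) *m S.
Proof.
move=> lev P S R; have [[orbO orb_inj _] orb_le] := iso.
have O n : orbits D (orb n) by apply: orbO.
have lev_inj i j y : lev i y -> lev j y -> i = j.
  move=> iy jy; apply/val_inj/(@addnI m)/orb_inj; rewrite ?inE //.
  exact: etrans (orbitsE (O _) iy) (esym (orbitsE (O _) jy)).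
(* By [hwedge], a join of factors has its orbit among the levels m, ..., M; no other [y]
   contributes. *)
have lev_wedge y h p : factors (partial_class D (orb l') c')
    (partial_class D (orb l'') c'') (y, h) p -> exists i, lev i y.
  move=> [[lp _ _] [lq _ _] [yE _]].
  have: orbit_wedge D (orb l') (orb l'') (orbit_of D y).
    by exists p.1.1 => //; exists p.2.1 => //; rewrite yE.
  rewrite hwedge => -[l /andP[ml lM] lE].
  have ltl : (l - m < (M - m).+1)%N by rewrite ltnS leq_sub2r.
  by exists (Ordinal ltl); rewrite /lev /= subnKC // lE; exact: orbit_of_self.
(* 1 + R is lower triangular with ones on the diagonal, so its determinant is 1. *)
have unitR : 1%:M + R \in unitmx.
  rewrite unitmxE det_trig; last first.
    apply/is_trig_mxP => i j ij; rewrite !mxE.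
    by rewrite -val_eqE ltn_eqF // ltnNge (ltnW ij) addr0.
  by rewrite big1 ?unitr1 // => i _; rewrite !mxE eqxx ltnn addr0.
suff -> : S = (1%:M + R) *m P by rewrite mulKmx.
apply/colP => i; rewrite mulmxDl mul1mx !mxE.
(* When [c] misses the group at level [i], the class of partial elements there is empty too, and
   every term takes its default value 0. *)
have [[h ih]|noh] := pselect (class_at D c (orbit_repr (lev i)) !=set0);
    last first.
  rewrite /Scoef (_ : class_at D c _ = set0); last first.
    by apply/eqP/negPn/negP => /set0P.
  rewrite coefficient_set0 ?mulr0; last by move=> X [].
  rewrite (_ : partial_class D (lev i) c = set0); last first.
    apply/seteqP; split=> // p pin; apply: noh; have [lp _ _] := pin.
    have [g gE] := orbits_trans (O _) lp (orbit_repr_in (O _)).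
    have [_ cg] := partial_class_act g (O _) hc pin.
    by rewrite /= -gE => sg; exists (g * p.2 * g^-1)%g.
  rewrite /Pcoef coefficient_set0; last by move=> X [].
  rewrite add0r big1 // => j _; rewrite !mxE xi_class_empty //.
  by case: ifP; rewrite mul0r.
(* The same [h] serves for all levels: any [y] at level [j] whose group contains [h] computes
   [P j 0]. *)
have PE j y : lev j y -> stab D y h ->
    P j 0 = cardk k (factors (partial_class D (orb l') c')
                       (partial_class D (orb l'') c'') (y, h)).
  move=> jy yh; rewrite mxE; apply: PcoefE => //; first exact: O.
  by split=> //; case: ih.
transitivity (\sum_j (xi D (lev j) c (lev i))%:R * P j 0).
  rewrite (xi_mul_Scoef adm std k (O _) hc' (O _) hc'' hc ih).
  set B := [set y : Lam | (y <= orbit_repr (lev i))%O /\ stab D y h].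
  have finB : finite_set B.
    by apply: sub_finite_set (finite_below adm (orbit_repr (lev i))) => y [].
  (* Each [y] belongs to at most one level by [lev_inj], and it has no factorization if it belongs
     to none. *)
  transitivity (\sum_(y \in B) \sum_j (if y \in lev j then P j 0 else 0)).
    apply: eq_fsbigr => y /[1!inE] -[yx yh].
    have [[j jy]|noj] := pselect (exists j, lev j y).
      rewrite (bigD1 j) //= mem_set // -(PE j y jy yh) big1 ?addr0 // => j' nj.
      by rewrite memNset // => /lev_inj/(_ jy)/eqP; rewrite (negbTE nj).
    rewrite big1 => [|j _];
      last by rewrite memNset // => jy; apply: noj; exists j.
    apply/eqP/contraT => /cardk_neq0[p] /lev_wedge[j jy].
    by case: noj; exists j.
  (* For fixed [j] the summand is constant on the elements of [B] at level [j], which [xiE]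
     counts. *)
  rewrite fsbig_finite // exchange_big /=; apply: eq_bigr => j _.
  rewrite -(fsbig_finite _ (fun y => if y \in lev j then P j 0 else 0)) //.
  rewrite -fsbig_mkcondr (xiE adm std k (O _) hc ih).
  rewrite /cardk mulr_fsuml.
  rewrite (_ : B `&` _ = below_with D (lev j) (orbit_repr (lev i)) h).
    by apply: eq_fsbigr => y _; rewrite mul1r.
  by apply/seteqP; split=> y; [case=> -[] | case].
have xi_ii : (xi D (lev i) c (lev i))%:R = 1 :> k.
  by apply: xi_self => //; [exact: O | exists h].
(* The term [j = i] is the contribution of the identity matrix; for [j > i] the term vanishes
   because [orb] reflects the order. *)
rewrite (bigD1 i) //= xi_ii mul1r.
rewrite mxE [in RHS](bigD1 i) //= mxE ltnn mul0r add0r; congr (_ + _).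
apply: eq_bigr => j ji; rewrite !mxE; case: ltngtP => // [ij|/val_inj jE].
  by rewrite (xi_not_le c (O _)) // => /orb_le; rewrite leq_add2l leqNgt ij.
by rewrite jE eqxx in ji.
Qed.
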